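(* Let $D,E$ be operators, $\langle W|$ a row vector and $|V\rangle$ a column vector satisfying $$DE-qED=D+E,\qquad \langle W|E=\langle W|,\qquad D|V\rangle=|V\rangle,\qquad \langle W|V\rangle=1 .$$ For integers $n\ge 1$ and $m\ge 0$, the coefficients of $q y^m$ and of $q^2y^m$ in the polynomial $\langle W|\,y(yD+E)^{n-1}|V\rangle$ are respectively $$ \binom{n}{m+1}\binom{n}{m-2} \qquad\text{and}\qquad \binom{n+1}{m-2} \binom{n+1}{m+2}\,\frac{nm+m-m^2-4}{2(n+1)}. $$
   Context: $q$ and $y$ are commuting indeterminates (scalars). $D,E$ are linear operators on a vector space over a field containing $\mathbb{Q}(q,y)$ (for instance, suitable infinite matrices), $|V\rangle$ is a vector of that space, and $\langle W|$ is a linear functional on it; $\langle W|X|V\rangle$ denotes the resulting scalar. The scalar $\langle W|(yD+E)^{n-1}|V\rangle$ depends only on the stated relations and is a polynomial in $q$ and $y$ with integer coefficients. Binomial coefficients $\binom{n}{k}$ with $n\ge 0$ are $0$ unless $0\le k\le n$. *)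

(* Defs.v *)
From HB Require Import structures.
From mathcomp Require Import all_boot all_order all_algebra.

Set Implicit Arguments.
Unset Strict Implicit.
Unset Printing Implicit Defensive.

Import GRing.Theory.
Local Open Scope ring_scope.

(* Bivariate polynomials are nested: the outer variable is y, the inner one is
   q, so that the coefficient of q^i y^m in P is P`_m`_i. *)
Definition Zqy := {poly {poly int}}.
Definition Qqy := {poly {poly rat}}.

Notation ratfun := {fraction {poly {poly rat}}}.

Definition ratfun_q : ratfun := tofrac ('X%:P : Qqy).
Definition ratfun_y : ratfun := tofrac ('X : Qqy).

Definition Zqy_to_ratfun (P : Zqy) : ratfun :=
  tofrac (map_poly (map_poly (intr : int -> rat)) P).

Definition coef_qy (P : Zqy) (i m : nat) : int := P`_m`_i.

(* The binomial coefficient with an integer lower index, zero when the lower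
   index is negative. *)
Definition binz (n : nat) (k : int) : nat :=
  if k is Posz j then 'C(n, j) else 0%N.

(* <W|y (y D + E)^(n-1)|V>, for n >= 1. *)
Definition matrix_ansatz_scalar (K : fieldType) (V : lmodType K) (y : K)
    (D E : V -> V) (W : V -> K) (v : V) (n : nat) : K :=
  W (y *: iter n.-1 (fun x : V => y *: D x + E x) v).

(* Main.v *)
Require Import Defs.
From HB Require Import structures.
From mathcomp Require Import all_boot all_order all_algebra.
From mathcomp Require Import ring zify.

Set Implicit Arguments.
Unset Strict Implicit.
Unset Printing Implicit Defensive.

Import Order.TTheory GRing.Theory Num.Theory.
Local Open Scope ring_scope.

(** The shifted operators A = (1 - q) D - 1 and B = (1 - q) E - 1 satisfy the
    q-oscillator relation A B = q B A + (1 - q), with <W|B = -q <W| and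
    A|V> = -q |V>, and (1 - q)(y D + E) = (1 + y) + y A + B.  Moving every B to
    the left, where <W| absorbs it, expands <W|((1 + y) + y A + B)^N in the
    functionals y^j <W|A^j.  The coefficients c(N, j) ([ansatz_coef]) count
    weighted Motzkin paths, and since A|V> = -q |V>
<<
      (1 - q)^N <W|(y D + E)^N|V> = \sum_j c(N, j) (-q y)^j
>>
    ([functional_expansion], [scaled_ansatz_expansion]).

    Only c(N, 0), c(N, 1), c(N, 2) matter modulo q^3.  In the recurrence for c
    the variable q occurs as q^(j+1) at height j, so modulo q^3 it perturbs only
    the two lowest levels.  At q = 0 the solution is the family b(N, k)
    ([ballot_poly]) of Motzkin paths from 0 to k with steps of weight 1 (up),
    1 + y (level), y (down), and the perturbed solution is a combination of
    b(N, j), ..., b(N, j + 3) ([ansatz_coef_mod]).  The reflection principle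
    gives
<<
      [y^j] b(N, k) = C(N, j) C(N, j + k) - C(N, j - 1) C(N, j + k + 1)
>>
    ([coef_ballot_poly]).  Dividing by (1 - q)^N turns this into formulas for
    the coefficients of q y^m and q^2 y^m ([coef_qy_ansatz]), and the two stated
    closed forms are then identities between products of binomial coefficients
    ([ballot_coef1], [ballot_coef2]).

    That the scalar is an integral polynomial at all is seen separately, by
    normal ordering D past E inside <W|D^i ... ([ansatz_integral]). *)

(** * Paths and their expansion modulo q^3 *)

Section PathPolynomials.

Variable R : comNzRingType.

(** The coefficient of y^j <W|A^j in <W|((1 + y) + y A + B)^N. *)
Fixpoint ansatz_coef (q y : R) (N j : nat) : R :=
  if N is N'.+1 then
    let c := ansatz_coef q y N' in
    (1 + y - q ^+ j.+1) * c j
      + (if j is j'.+1 then c j' else 0) + y * (1 - q ^+ j.+1) * c j.+1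
  else (j == 0%N)%:R.

Lemma ansatz_coef_gt (q y : R) N j : (N < j)%N -> ansatz_coef q y N j = 0.
Proof.
elim: N j => [|N IHN] [|j] //= ltNj.
by rewrite !IHN ?mulr0 ?addr0 //; lia.
Qed.

Fixpoint ballot_poly (y : R) (N k : nat) : R :=
  if N is N'.+1 then
    let b := ballot_poly y N' in
    (1 + y) * b k + (if k is k'.+1 then b k' else 0) + y * b k.+1
  else (k == 0%N)%:R.

(** The value of [ansatz_coef] modulo q^3.  With X = y A + B, the power
    ((1 + y) + X)^N is \sum_k b(N, k) U_k(X), where U_0 = 1, U_1 = X and
    U_{k+1} = X U_k - y U_{k-1}.  The formula is what remains modulo q^3 after
    two triangular changes of basis: from the U_k to the continuous q-Hermite
    polynomials, whose normal ordering is \sum_i [k, i]_q y^(k-i) B^i A^(k-i),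
    and from these to the powers of A, by applying <W|.  The q-binomials that
    occur are q [j + 1]_q, which reduces to e, and q^2 [j + 2, 2]_q, which
    reduces to q^2; so the shape depends on j only at the boundary j = 0. *)
Definition ansatz_coef3 (q y : R) (N j : nat) : R :=
  let b := ballot_poly y N in
  let e := if j is 0%N then q else q + q ^+ 2 in
  b j - e * b j.+1 + (q ^+ 2 - y * e) * b j.+2 + y * q ^+ 2 * b j.+3.

(** Away from the boundary [ansatz_coef3] is a combination, with coefficients
    independent of j, of translates of b, so it obeys the recurrence of b; the
    missing terms carry q^(j+1).  At j = 0 and j = 1 these terms are not
    multiples of q^3, and are compensated by the change of e at j = 0 and by the
    absence of a level below 0. *)
Lemma ansatz_coef_mod (q y : R) N j :
  exists z, ansatz_coef q y N j = ansatz_coef3 q y N j + q ^+ 3 * z.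
Proof.
elim: N j => [|N IHN] j.
  exists 0; rewrite /ansatz_coef3 /=.
  by case: j => [|j] /=; rewrite !mulr0n; ring.
have [z0 c0] := IHN j; have [z1 c1] := IHN j.+1.
pose b := ballot_poly y N.
case: j c0 c1 => [|j] c0 c1.
  exists ((1 + y - q) * z0 + y * (1 - q) * z1
    + ((y - 1) * b 2%N + (y ^+ 2 - 2%:R * y) * b 3%N - y ^+ 2 * b 4%N)).
  by rewrite /= {}c0 {}c1 /ansatz_coef3 /= -/b; ring.
have [zm cm] := IHN j.
case: j c0 c1 cm => [|j] c0 c1 cm.
  exists ((1 + y - q ^+ 2) * z0 + zm + y * (1 - q ^+ 2) * z1
    - (- (1 + q) * b 2%N + (q - y * (1 + q)) * b 3%N + y * q * b 4%N
       + y * (- (1 + q) * b 3%N + (q - y * (1 + q)) * b 4%N + y * q * b 5%N))).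
  by rewrite /= {}c0 {}c1 {}cm /ansatz_coef3 /= -/b; ring.
exists ((1 + y - q ^+ j.+3) * z0 + zm + y * (1 - q ^+ j.+3) * z1
  - q ^+ j * (ansatz_coef3 q y N j.+2 + y * ansatz_coef3 q y N j.+3)).
by rewrite /= {}c0 {}c1 {}cm /ansatz_coef3 /= -/b !exprS; ring.
Qed.

(** The factor (-q y)^j makes all terms with j >= 3 vanish modulo q^3. *)
Lemma ansatz_sum_mod (q y : R) N :
  let b := ballot_poly y N in
  exists z, \sum_(j < N.+3) ansatz_coef q y N j * (- (q * y)) ^+ j
    = b 0%N - q * ((1 + y) * b 1%N + y * b 2%N)
      + q ^+ 2 * ((1 + y + y ^+ 2) * b 2%N + (y + y ^+ 2) * b 3%N)
      + q ^+ 3 * z.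
Proof.
move=> b; have [z0 c0] := ansatz_coef_mod q y N 0.
have [z1 c1] := ansatz_coef_mod q y N 1.
have [z2 c2] := ansatz_coef_mod q y N 2.
pose F j := ansatz_coef q y N j * (- (q * y)) ^+ j.
have tailE : \sum_(j < N) F j.+3
    = q ^+ 3 * \sum_(j < N) ansatz_coef q y N j.+3
                            * (- y ^+ 3 * (- (q * y)) ^+ j).
  by rewrite mulr_sumr; apply: eq_bigr => j _; rewrite /F !exprS; ring.
rewrite -(big_mkord xpredT F) !big_nat_recl // big_mkord tailE /F c0 c1 c2.
set t := \sum_(j < N) _; rewrite /ansatz_coef3 -/b.
exists (z0 - q * y * z1 + q ^+ 2 * y ^+ 2 * z2 + t
  + (y * b 2%N - (y + q * y ^+ 2) * b 3%N
     + y ^+ 2 * (q - 1 - y - y * q) * b 4%N + q * y ^+ 3 * b 5%N)).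
by ring.
Qed.

End PathPolynomials.

Lemma rmorph_ansatz_coef (R S : comNzRingType) (f : {rmorphism R -> S}) q y N j :
  f (ansatz_coef q y N j) = ansatz_coef (f q) (f y) N j.
Proof.
elim: N j => [|N IHN] j /=; first exact: rmorph_nat.
have fX i : f (q ^+ i) = f q ^+ i by exact: rmorphXn.
by case: j => [|j]; rewrite 2!rmorphD !rmorphM !rmorphB rmorphD !fX !rmorph1
  !IHN ?rmorph0.
Qed.

(** * The operators *)

Section MatrixAnsatz.

Variables (K : comNzRingType) (V : lmodType K) (q y : K).

Section Oscillator.

Variables (A B : {linear V -> V}) (W : {scalar V}).
Hypothesis AB : forall x, A (B x) = q *: B (A x) + (1 - q) *: x.
Hypothesis WB : forall x, W (B x) = - q * W x.

(** For j = 0 the ill-defined power A^(j-1) has coefficient 1 - q^0 = 0. *)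
Lemma iter_oscillator j x :
  iter j A (B x) = q ^+ j *: B (iter j A x) + (1 - q ^+ j) *: iter j.-1 A x.
Proof.
elim: j => [|j IHj]; first by rewrite /= scale1r subrr scale0r addr0.
rewrite iterS IHj linearD !linearZ AB /= scalerDr !scalerA -exprSr -addrA.
congr (_ + _); case: j {IHj} => [|j] /=.
  by rewrite expr0 subrr scale0r addr0 mul1r.
by rewrite -scalerDl; congr (_ *: _); rewrite [in RHS]exprSr; ring.
Qed.

Let om j x := y ^+ j * W (iter j A x).

Lemma functional_step j x :
  om j ((1 + y) *: x + y *: A x + B x) =
    (1 + y - q ^+ j.+1) * om j x + om j.+1 x
      + (if j is j'.+1 then y * (1 - q ^+ j) * om j' x else 0).
Proof.
have iterL i a z u : iter i A (a *: z + u) = a *: iter i A z + iter i A u.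
  by elim: i => //= i ->; rewrite linearD linearZ.
have WL a z u : W (a *: z + u) = a * W z + W u by rewrite linearP.
have WZ a z : W (a *: z) = a * W z by rewrite linearZ.
rewrite /om -addrA !iterL iter_oscillator !WL WZ WB -iterSr.
by case: j => [|j]; rewrite ?iterS !exprS /=; ring.
Qed.

(** Any bound M beyond N will do, as the coefficients vanish above N; keeping it
    fixed lets the induction shift the index by one in either direction. *)
Lemma functional_expansion N M x : (N < M)%N ->
  W (iter N (fun z => (1 + y) *: z + y *: A z + B z) x) =
    \sum_(j < M) ansatz_coef q y N j * om j x.
Proof.
elim: N x => [|N IHN] x ltNM.
  case: M ltNM => // M _; rewrite big_ord_recl big1 ?addr0 /= => [|i _].
    by rewrite /om expr0 !mul1r.
  by rewrite mul0r.
rewrite iterSr IHN ?(ltnW ltNM) //.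
under eq_bigr => j _ do rewrite functional_step 2!mulrDr.
rewrite !big_split.
under [RHS]eq_bigr => j _ do rewrite /= 2!mulrDl.
rewrite !big_split /= -!addrA; congr (_ + _).
  by apply: eq_bigr => j _; rewrite mulrCA mulrA.
case: M {IHN} ltNM => // M ltNM; congr (_ + _).
  rewrite big_ord_recr [RHS]big_ord_recl /= ansatz_coef_gt //.
  by rewrite !mul0r addr0 add0r; apply: eq_bigr.
rewrite big_ord_recl [RHS]big_ord_recr /=.
rewrite [in RHS](ansatz_coef_gt _ _ (_ : N < M.+1)%N); last by lia.
rewrite !mulr0 mul0r addr0 add0r.
by apply: eq_bigr => j _; ring.
Qed.

End Oscillator.

Variables (D E : {linear V -> V}) (W : {scalar V}) (v : V).
Hypothesis DE : forall x, D (E x) - q *: E (D x) = D x + E x.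
Hypothesis WE : forall x, W (E x) = W x.
Hypothesis Dv : D v = v.
Hypothesis Wv : W v = 1.

Let M x := y *: D x + E x.

Let DEE x : D (E x) = q *: E (D x) + D x + E x.
Proof. by rewrite -addrA -DE addrC subrK. Qed.

Lemma scaled_ansatz_expansion N B : (N < B)%N ->
  (1 - q) ^+ N * W (iter N M v)
    = \sum_(j < B) ansatz_coef q y N j * (- (q * y)) ^+ j.
Proof.
move=> ltNB; pose A' : {linear V -> V} := (1 - q) \*: D \- idfun.
pose B' : {linear V -> V} := (1 - q) \*: E \- idfun.
have A'E x : A' x = (1 - q) *: D x - x by [].
have B'E x : B' x = (1 - q) *: E x - x by [].
have WL a z u : W (a *: z - u) = a * W z - W u by rewrite linearB linearZ.
have A'B' x : A' (B' x) = q *: B' (A' x) + (1 - q) *: x.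
  (* Both sides are compared as combinations of ED x, D x, E x and x. *)
  pose comb a b c d := a *: E (D x) + b *: D x + c *: E x + d *: x.
  have combD a b c d a' b' c' d' : comb a b c d + comb a' b' c' d'
      = comb (a + a') (b + b') (c + c') (d + d').
    rewrite /comb !scalerDl addrACA; congr (_ + _).
    by rewrite addrACA; congr (_ + _); rewrite addrACA.
  have combZ k a b c d :
      k *: comb a b c d = comb (k * a) (k * b) (k * c) (k * d).
    by rewrite /comb !scalerDr !scalerA.
  have combN a b c d : - comb a b c d = comb (- a) (- b) (- c) (- d).
    by rewrite /comb !scaleNr !opprD.
  have EDc : E (D x) = comb 1 0 0 0 by rewrite /comb !scale0r !addr0 scale1r.
  have Dc : D x = comb 0 1 0 0.
    by rewrite /comb !scale0r !addr0 add0r scale1r.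
  have Ec : E x = comb 0 0 1 0.
    by rewrite /comb !scale0r !addr0 !add0r scale1r.
  have xc : x = comb 0 0 0 1 by rewrite /comb !scale0r !add0r scale1r.
  have DEc : D (E x) = comb q 1 1 0.
    by rewrite /comb scale0r !scale1r addr0 DEE.
  rewrite !A'E !B'E !linearB !linearZ /=.
  rewrite DEc EDc Dc Ec xc.
  by rewrite !(combN, combZ, combD); congr comb; ring.
have WB' x : W (B' x) = - q * W x by rewrite B'E WL WE; ring.
have A'Z a z : A' (a *: z) = a *: A' z by exact: linearZZ.
have A'v j : iter j A' v = (- q) ^+ j *: v.
  elim: j => [|j IHj]; first by rewrite scale1r.
  rewrite iterS IHj A'Z A'E Dv exprSr -scalerA; congr (_ *: _).
  by rewrite -{2}[v]scale1r -scalerBl; congr (_ *: _); ring.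
have := functional_expansion A'B' WB' v ltNB.
have step u : (1 + y) *: u + y *: A' u + B' u = (1 - q) *: M u.
  rewrite A'E B'E /M scalerDl scale1r scalerBr scalerDr !scalerA [y * _]mulrC.
  by rewrite [_ - y *: u]addrC !addrA addrK addrC !addrA addNr add0r.
have -> : iter N (fun z => (1 + y) *: z + y *: A' z + B' z) v
    = (1 - q) ^+ N *: iter N M v.
  elim: N {ltNB} => [|N IHN]; first by rewrite scale1r.
  have MZ c u : M (c *: u) = c *: M u.
    by rewrite /M scalerDr !linearZ /= !scalerA [c * _]mulrC.
  by rewrite iterS {}IHN step MZ scalerA -exprS.
rewrite linearZ /= => ->; apply: eq_bigr => j _.
by rewrite A'v linearZ /= Wv mulr1 -exprMn; congr (_ * _ ^+ _); ring.
Qed.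

(** The expansion above only shows that the scalar becomes a polynomial after
    multiplication by (1 - q)^N.  No denominator appears because the vectors x
    all of whose values W (D^i x) lie in the image of f are stable under D, and
    also under E: the commutation relation lowers the power of D in front of E
    one step at a time, and W absorbs E once it is leftmost. *)
Lemma ansatz_integral (R : comNzRingType) (f : {rmorphism R -> K}) (q0 y0 : R) :
  f q0 = q -> f y0 = y ->
  forall N, exists P, W (iter N M v) = f P.
Proof.
move=> fq fy.
pose good x := forall i, exists P, W (iter i D x) = f P.
suff goodM N : good (iter N M v) by move=> N; exact: (goodM N 0%N).
have iterL i a z u : iter i D (a *: z + u) = a *: iter i D z + iter i D u.
  by elim: i => //= k ->; rewrite linearD linearZ.
have iterD i z u : iter i D (z + u) = iter i D z + iter i D u.
  by have := iterL i 1 z u; rewrite !scale1r.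
have goodD x : good x -> good (D x) by move=> gx i; rewrite -iterSr; apply: gx.
have goodE x : good x -> good (E x).
  move=> gx i; elim: i x gx => [|i IHi] x gx.
    by have [P fP] := gx 0%N; exists P; rewrite /= WE.
  have [P fP] := IHi _ (goodD _ gx); have [P' fP'] := gx i.+1.
  have [Q fQ] := IHi _ gx; exists (q0 * P + P' + Q).
  rewrite iterSr DEE iterD iterL -iterSr !linearD linearZ fP fP' fQ.
  by rewrite !rmorphD rmorphM fq.
elim: N => [|N IHN] i.
  exists 1; rewrite rmorph1.
  by elim: i => //= i; rewrite -iterS iterSr Dv.
have [P fP] := goodD _ IHN i; have [Q fQ] := goodE _ IHN i.
exists (y0 * P + Q).
by rewrite iterS iterL linearD linearZ /= fP fQ rmorphD rmorphM fy.
Qed.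

End MatrixAnsatz.

(** * Ballot numbers *)

Lemma binz_pascal N k : binz N.+1 k = (binz N k + binz N (k - 1))%N.
Proof.
case: k => [[|k]|k]; first by rewrite /= !bin0.
  by have -> : Posz k.+1 - 1 = k by lia.
by have -> : Negz k - 1 = Negz k.+1 by lia.
Qed.

(** Indices range over the integers, so that the recurrence and the shifts by
    powers of y hold without boundary cases. *)
Definition ballot_num (N : nat) (k j : int) : int :=
  (binz N j)%:Z * (binz N (j + k))%:Z
  - (binz N (j - 1))%:Z * (binz N (j + k + 1))%:Z.

Lemma ballot_num_pascal N k j :
  ballot_num N.+1 k j = ballot_num N k j + ballot_num N k (j - 1)
    + ballot_num N (k - 1) j + ballot_num N (k + 1) (j - 1).
Proof.
rewrite /ballot_num !binz_pascal.
have -> : j + k + 1 - 1 = j + k by ring.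
have -> : j - 1 + k = j + k - 1 by ring.
have -> : j + k - 1 + 1 = j + k by ring.
have -> : j + (k - 1) = j + k - 1 by ring.
have -> : j + k - 1 + 1 = j + k by ring.
have -> : j - 1 + (k + 1) = j + k by ring.
by rewrite !PoszD; ring.
Qed.

Lemma ballot_num_lt0 N k j : j < 0 -> ballot_num N k j = 0.
Proof. by case: j. Qed.

(** The reflection principle: -1 is the fixed height of the reflection that
    exchanges the two products. *)
Lemma ballot_numN1 N j : ballot_num N (-1) j = 0.
Proof. by rewrite /ballot_num subrK; ring. Qed.

Lemma coef_ballot_poly N k j :
  (ballot_poly ('X : {poly {poly int}}) N k)`_j = (ballot_num N k j)%:P.
Proof.
elim: N k j => [|N IHN] k j.
  have binz0 i : binz 0 i = (i == 0) by case: i => [[|i]|i].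
  rewrite /ballot_num !binz0.
  have natC (b : bool) : b%:R = (b%:R : int)%:P%:P :> Zqy by case: b.
  rewrite /= natC coefC.
  by case: k => [|k]; case: j => [|j] /=; rewrite ?mulr0 ?mul0r ?subr0.
rewrite ballot_num_pascal.
have -> : k%:Z + 1 = k.+1 by lia.
have negE i : ballot_num N i (0%N%:Z - 1) = 0 by apply: ballot_num_lt0.
have predE i : i.+1%:Z - 1 = i by lia.
case: k => [|k].
  rewrite (ballot_numN1 _ _ : ballot_num N (0%N%:Z - 1) j = 0).
  rewrite [ballot_poly _ _ _]/= mulrDl mul1r !coefD !coefXM !IHN coef0.
  by case: j => [|j]; rewrite ?negE ?predE ?IHN -?polyC0 -!polyCD.
rewrite [ballot_poly _ _ _]/= mulrDl mul1r !coefD !coefXM !IHN (predE k).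
by case: j => [|j]; rewrite ?negE ?predE ?IHN -?polyC0 -!polyCD.
Qed.

Lemma coef_Xn_ballot_poly N k a m :
  ('X^a * ballot_poly ('X : Zqy) N k)`_m = (ballot_num N k (m%:Z - a%:Z))%:P.
Proof.
rewrite coefXnM; case: ltnP => [ltma|leam].
  by rewrite ballot_num_lt0 //; lia.
by rewrite coef_ballot_poly; congr (ballot_num _ _ _)%:P; lia.
Qed.

(** * Extracting the coefficients *)

Lemma coef_1subX_exp (p : {poly int}) N :
  [/\ ((1 - 'X) ^+ N * p)`_0 = p`_0,
      ((1 - 'X) ^+ N * p)`_1 = p`_1 - N%:Z * p`_0
    & ((1 - 'X) ^+ N * p)`_2 = p`_2 - N%:Z * p`_1 + 'C(N, 2)%:Z * p`_0].
Proof.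
elim: N => [|N [IH0 IH1 IH2]].
  by rewrite expr0 mul1r bin_small //; split; ring.
rewrite exprS -mulrA mulrBl mul1r !coefB !coefXM /= IH0 IH1 IH2 binS bin1.
by rewrite -addn1 !PoszD; split; ring.
Qed.

Local Notation Zq := ('X%:P : Zqy).
Local Notation Zy := ('X : Zqy).

Lemma coef_qy_ansatz (P : Zqy) N :
  (1 - Zq) ^+ N * P
    = Zy * \sum_(j < N.+3) ansatz_coef Zq Zy N j * (- (Zq * Zy)) ^+ j ->
  forall m,
    let c0 := ballot_num N 0 (m%:Z - 1) in
    let c1 := ballot_num N 1 (m%:Z - 1) + ballot_num N 1 (m%:Z - 2)
              + ballot_num N 2 (m%:Z - 2) in
    let c2 := ballot_num N 2 (m%:Z - 1) + ballot_num N 2 (m%:Z - 2)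
              + ballot_num N 2 (m%:Z - 3)
              + (ballot_num N 3 (m%:Z - 2) + ballot_num N 3 (m%:Z - 3)) in
  coef_qy P 1 m = N%:Z * c0 - c1 /\
  coef_qy P 2 m = N%:Z * (N%:Z * c0 - c1) - 'C(N, 2)%:Z * c0 + c2.
Proof.
move=> defP m c0 c1 c2.
have [z sumE] := ansatz_sum_mod ('X%:P : Zqy) 'X N.
(* [coefE] and [lowE] have arbitrary summands, which keeps rewriting from
   unfolding the ballot numbers. *)
have coefE (Y0 Y1 Y2 Y3 Y4 Y5 Y6 Y7 Y8 Z : Zqy) :
    (Y0 - 'X%:P * (Y1 + Y2 + Y3) + ('X^2)%:P * (Y4 + Y5 + Y6 + (Y7 + Y8))
       + ('X^3)%:P * Z)`_m
    = Y0`_m - 'X * (Y1`_m + Y2`_m + Y3`_m)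
      + 'X^2 * (Y4`_m + Y5`_m + Y6`_m + (Y7`_m + Y8`_m)) + 'X^3 * Z`_m.
  by rewrite 2!coefD coefB !coefCM !coefD.
have defPm : (1 - 'X) ^+ N * P`_m = ((1 - 'X%:P) ^+ N * P)`_m.
  by rewrite -coefCM rmorphXn rmorphB rmorph1.
have lowE (a0 a1 a2 a3 a4 a5 a6 a7 a8 : int) (t : {poly int}) :
    let p := a0%:P - 'X * (a1%:P + a2%:P + a3%:P)
      + 'X^2 * (a4%:P + a5%:P + a6%:P + (a7%:P + a8%:P)) + 'X^3 * t in
    [/\ p`_0 = a0, p`_1 = - (a1 + a2 + a3)
      & p`_2 = a4 + a5 + a6 + (a7 + a8)].
  rewrite /= -!polyCD; split; rewrite 2!coefD coefB coefXM !coefXnM !coefC /=;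
    by rewrite !addr0 ?subr0 ?add0r.
have [e0 e1 e2] := coef_1subX_exp P`_m N.
move: e0 e1 e2; rewrite defPm defP sumE; set b := ballot_poly _ _.
rewrite (_ : 'X * _
    = 'X^1 * b 0%N
      - 'X%:P * ('X^1 * b 1%N + 'X^2 * b 1%N + 'X^2 * b 2%N)
      + ('X^2)%:P * ('X^1 * b 2%N + 'X^2 * b 2%N + 'X^3 * b 2%N
                     + ('X^2 * b 3%N + 'X^3 * b 3%N))
      + ('X^3)%:P * ('X * z)); last first.
  by rewrite -!polyC_exp; ring.
rewrite coefE !coef_Xn_ballot_poly.
set p := (X in X`_0).
have [-> -> ->] : [/\ p`_0 = c0, p`_1 = - c1 & p`_2 = c2] by exact: lowE.
rewrite /coef_qy => -> e1 e2; clear p; clearbody c1 c2.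
have P1E : P`_m`_1 = N%:Z * P`_m`_0 - c1 by rewrite e1 addrC subrK.
by split=> //; rewrite -P1E e2; ring.
Qed.

(** * Closed forms *)

(** This holds for t > n as well, one of the factors being zero. *)
Lemma natr_ffact (R : comPzRingType) (n t : nat) :
  (n ^_ t)%:R = \prod_(i < t) (n%:R - i%:R) :> R.
Proof.
elim: t => [|t IHt]; first by rewrite big_ord0.
rewrite ffactnSr big_ord_recr /= natrM {}IHt.
have [letn|ltnt] := leqP t n; first by rewrite natrB.
by rewrite (bigD1 (Ordinal ltnt)) //= subrr !mul0r.
Qed.

(** Consecutive binomial coefficients are polynomial multiples of a common
    factor u, namely N! / ((m + s)! (N - m)!), or 0 when the window
    m, ..., m + s misses 0, ..., N altogether; when it overlaps partially, the
    polynomials vanish at the indices outside 0, ..., N.  Identities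
    between products of binomial coefficients thus reduce to polynomial
    identities, with neither division nor boundary cases. *)
Lemma binz_window (N : nat) (m : int) (s : nat) :
  exists u : rat, forall t : nat, (t <= s)%N ->
    (binz N (m + t%:Z))%:R
      = u * \prod_(i < s - t) ((m + s%:Z)%:~R - i%:R)
          * \prod_(i < t) ((N%:Z - m)%:~R - i%:R).
Proof.
have [[M defM]|ms_lt0] : (exists M : nat, m + s%:Z = M) \/ (m + s%:Z < 0).
- by case: (m + s%:Z) => k; [left; exists k | right].
have [[d defd]|Nm_lt0] : (exists d : nat, N%:Z - m = d) \/ (N%:Z - m < 0).
- by case: (N%:Z - m) => k; [left; exists k | right].
- exists (N`!%:R / (M`!%:R * d`!%:R)) => t le_ts.
  rewrite defM defd -!pmulrn -!natr_ffact.
  case defa: (m + t%:Z) => [a|a] /=; last first.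
    by rewrite (ffact_small (_ : (M < s - t)%N)) ?mulr0 ?mul0r //; lia.
  have [le_aN|lt_Na] := leqP a N; last first.
    by rewrite bin_small // (ffact_small (_ : (d < t)%N)) ?mulr0 //; lia.
  have facM : (M ^_ (s - t) * a`! = M`!)%N.
    have -> : a = (M - (s - t))%N by lia.
    by rewrite ffact_fact //; lia.
  have facd : (d ^_ t * (N - a)`! = d`!)%N.
    have -> : (N - a = d - t)%N by lia.
    by rewrite ffact_fact //; lia.
  have nz k : k`!%:R != 0 :> rat by rewrite pnatr_eq0 -lt0n fact_gt0.
  rewrite -(bin_fact le_aN) -facM -facd.
  have := nz M; have := nz d; rewrite -facM -facd !natrM !mulf_eq0 !negb_or.
  by move=> /andP[? ?] /andP[? ?]; field; do ?[apply/andP; split].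
- exists 0 => t le_ts; rewrite !mul0r.
  by case defa: (m + t%:Z) => [a|a] //=; rewrite bin_small //; lia.
exists 0 => t le_ts; rewrite !mul0r.
by case defa: (m + t%:Z) => [a|a] //=; lia.
Qed.

Lemma ballot_num_binz N (a : int) (k t : nat) :
  let w i := (binz N (a + i%:Z))%:R : rat in
  (ballot_num N k (a + t.+1%:Z))%:~R
    = w t.+1 * w (t.+1 + k)%N - w t * w (t + k).+2.
Proof.
move=> w; rewrite /ballot_num rmorphB !rmorphM /= /w -!pmulrn.
by congr (_ * (binz _ _)%:R - (binz _ _)%:R * (binz _ _)%:R); lia.
Qed.

Lemma ballot_coef1 N (m : int) :
  N%:Z * ballot_num N 0 (m - 1)
    - (ballot_num N 1 (m - 1) + ballot_num N 1 (m - 2) + ballot_num N 2 (m - 2))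
  = (binz N.+1 (m + 1) * binz N.+1 (m - 2))%N%:Z.
Proof.
apply: (@intr_inj rat).
have [u wE] := binz_window N (m - 3) 4.
have -> : m - 1 = m - 3 + 2%N by ring.
have -> : m - 2 = m - 3 + 1%N by ring.
have -> : m + 1 = m - 3 + 4%N by ring.
rewrite !binz_pascal.
have -> : m - 3 + 4%N - 1 = m - 3 + 3%N by ring.
have -> : m - 3 + 1%N - 1 = m - 3 + 0%N by ring.
have castE a b c d : (N%:Z * a - (b + c + d))%:~R
    = N%:R * a%:~R - (b%:~R + c%:~R + d%:~R) :> rat.
  by rewrite rmorphB rmorphM !rmorphD.
rewrite castE !ballot_num_binz -[RHS]pmulrn natrM !natrD.
rewrite !wE //= !big_ord_recr !big_ord0 /= !rmorphB /= !rmorphD /= -!pmulrn.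
by ring.
Qed.

Lemma ballot_coef2 N (m : int) :
  (N%:Z * (N%:Z * ballot_num N 0 (m - 1)
      - (ballot_num N 1 (m - 1) + ballot_num N 1 (m - 2)
         + ballot_num N 2 (m - 2)))
    - 'C(N, 2)%:Z * ballot_num N 0 (m - 1)
    + (ballot_num N 2 (m - 1) + ballot_num N 2 (m - 2) + ballot_num N 2 (m - 3)
       + (ballot_num N 3 (m - 2) + ballot_num N 3 (m - 3))))%:~R
  = (binz N.+2 (m - 2))%:R * (binz N.+2 (m + 2))%:R
    * ((N.+1%:R * m%:~R + m%:~R - m%:~R ^+ 2 - 4%:R)
       / (2%:R * (N.+1%:R + 1))) :> rat.
Proof.
have [u wE] := binz_window N (m - 4) 6.
have -> : m - 1 = m - 4 + 3%N by ring.
have -> : m - 2 = m - 4 + 2%N by ring.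
have -> : m - 3 = m - 4 + 1%N by ring.
have -> : m + 2 = m - 4 + 6%N by ring.
rewrite !binz_pascal.
have -> : m - 4 + 6%N - 1 = m - 4 + 5%N by ring.
have -> : m - 4 + 5%N - 1 = m - 4 + 4%N by ring.
have -> : m - 4 + 2%N - 1 = m - 4 + 1%N by ring.
have -> : m - 4 + 1%N - 1 = m - 4 + 0%N by ring.
have binE : 'C(N, 2)%:R = N%:R * (N%:R - 1) / 2%:R :> rat.
  have := natr_ffact rat N 2.
  rewrite -bin_ffact natrM !big_ord_recr big_ord0 /= => CE.
  by apply: (@mulIf _ 2%:R); rewrite // divfK // CE; ring.
have castE a0 a1 a2 a3 b1 b2 b3 b4 b5 : (N%:Z * (N%:Z * a0 - (a1 + a2 + a3))
      - 'C(N, 2)%:Z * a0 + (b1 + b2 + b3 + (b4 + b5)))%:~R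
    = N%:R * (N%:R * a0%:~R - (a1%:~R + a2%:~R + a3%:~R))
      - 'C(N, 2)%:R * a0%:~R
      + (b1%:~R + b2%:~R + b3%:~R + (b4%:~R + b5%:~R)) :> rat.
  by rewrite rmorphD rmorphB !rmorphM rmorphB rmorphM !rmorphD.
rewrite castE !ballot_num_binz binE !natrD.
rewrite !wE //= !big_ord_recr !big_ord0 /= !(rmorphB, rmorphD) /= -!pmulrn.
rewrite -natr1; field.
by rewrite nat1r natr1 pnatr_eq0.
Qed.

Theorem proposition13 (K : fieldType) (iota : {rmorphism ratfun -> K})
    (V : lmodType K) (D E : {linear V -> V}) (W : {scalar V}) (v : V)
    (hDE : forall x : V, D (E x) - iota ratfun_q *: E (D x) = D x + E x)
    (hW : forall x : V, W (E x) = W x)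
    (hV : D v = v)
    (hWV : W v = 1)
    (n : nat) (hn : (1 <= n)%N) :
  (exists P : Zqy,
     matrix_ansatz_scalar (iota ratfun_y) D E W v n = iota (Zqy_to_ratfun P))
  /\
  (forall P : Zqy,
     matrix_ansatz_scalar (iota ratfun_y) D E W v n = iota (Zqy_to_ratfun P) ->
     forall m : nat,
       coef_qy P 1 m = (binz n (m%:Z + 1) * binz n (m%:Z - 2))%N%:Z
       /\
       (coef_qy P 2 m)%:~R =
         (binz n.+1 (m%:Z - 2))%:R * (binz n.+1 (m%:Z + 2))%:R
         * ((n%:R * m%:R + m%:R - m%:R ^+ 2 - 4%:R) / (2%:R * (n%:R + 1)))
         :> rat).
Proof.
case: n hn => // N _.
pose f : {rmorphism Zqy -> K} :=
  iota \o (@tofrac Qqy \o map_poly (map_poly (intr : int -> rat))).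
have fE P : iota (Zqy_to_ratfun P) = f P by [].
have fq : f 'X%:P = iota ratfun_q.
  by rewrite -fE /Zqy_to_ratfun map_polyC /= map_polyX.
have fy : f 'X = iota ratfun_y by rewrite -fE /Zqy_to_ratfun map_polyX.
have f_inj : injective f.
  move=> P Q /fmorph_inj/eqP; rewrite tofrac_eq => /eqP.
  have inj_map_intr := map_inj_poly (@intr_inj rat) (rmorph0 _).
  exact: (map_inj_poly inj_map_intr (rmorph0 _)).
rewrite /matrix_ansatz_scalar /= linearZ /=; split.
  have [P fP] := ansatz_integral hDE hW hV hWV fq fy N.
  by exists ('X * P); rewrite fE rmorphM fy fP.
move=> P fP m.
have [] := @coef_qy_ansatz P N _ m.
  apply: f_inj; rewrite !rmorphM rmorphXn rmorphB rmorph1 fq fy -fE -fP mulrCA.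
  congr (_ * _).
  rewrite (scaled_ansatz_expansion _ hDE hW hV hWV (leqW (leqnSn N.+1))).
  rewrite rmorph_sum; apply: eq_bigr => j _.
  by rewrite rmorphM rmorph_ansatz_coef rmorphXn rmorphN rmorphM fq fy.
move=> -> ->; split; first exact: ballot_coef1.
exact: ballot_coef2.
Qed.
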